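(* Let $\Bbbk$ be a field and $A$ a finite-dimensional $\Bbbk$-algebra. The $\Bbbk$-linear equivalence $F_A:\mathsf{Klcrep}(A)\to\mathsf{rep}(A)$ restricts to an equivalence $$\mathsf{Klcrep}^{\mathrm{proj}}(A)\simeq\mathsf{proj}(A),$$ where $\mathsf{Klcrep}^{\mathrm{proj}}(A)$ is the full subcategory of projective Kleisli convolution representations of $A$ and $\mathsf{proj}(A)$ is the category of finite-dimensional projective left $A$-modules.
   Context: $A$ is associative with identity; $\mathsf{rep}(A)$ is the category of finite-dimensional left $A$-modules. Let $\mathbf 1=\{\bullet\}$, and for a finite set $X$ put $E_X=X\times X$. For a set $X$, $\mathcal M_{\Bbbk}(X)$ is the $\Bbbk$-vector space of finite formal sums $\sum_{x\in X}a_x[x]$; $\mathscr M_{\Bbbk}$ is the corresponding free $\Bbbk$-module monad on $\mathsf{Set}$ (unit $x\mapsto[x]$, multiplication given by expanding formal sums of formal sums). A Kleisli arrow $f:X\rightsquigarrow Y$ is a map $f:X\to\mathcal M_{\Bbbk}(Y)$, $f(x)=\sum_y f_{y,x}[y]$, with matrix $[f]=(f_{y,x})$; Kleisli composition satisfies $[h\circ_{\mathsf{Kl}}f]=[h][f]$. For finite $X$, $\mathbb H_{\Bbbk}(X)=\mathrm{Hom}_{\mathsf{Kl}(\mathscr M_{\Bbbk})}(\mathbf 1,E_X)$ is a unital $\Bbbk$-algebra with pointwise linear structure and Kleisli convolution as multiplication: if $f(\bullet)=\sum f_{i,j}[(i,j)]$ and $g(\bullet)=\sum g_{i,j}[(i,j)]$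 then $(f\ast g)(\bullet)=\sum_{i,q}(\sum_j f_{i,j}g_{j,q})[(i,q)]$; its unit is $u_X(\bullet)=\sum_x[(x,x)]$. $\Phi_X:\mathbb H_{\Bbbk}(X)\to\mathrm{Mat}_X(\Bbbk)$, $f\mapsto(f_{i,j})$, is an isomorphism of $\Bbbk$-algebras. A Kleisli convolution representation of $A$ is a pair $(X,\theta)$ with $X$ a finite set and $\theta:A\to\mathbb H_{\Bbbk}(X)$ a unital $\Bbbk$-algebra homomorphism. A homomorphism $(X,\theta_X)\to(Y,\theta_Y)$ is a Kleisli arrow $f:X\rightsquigarrow Y$ with $\Phi_Y(\theta_Y(a))[f]=[f]\Phi_X(\theta_X(a))$ for all $a\in A$. These form the $\Bbbk$-linear category $\mathsf{Klcrep}(A)$ under Kleisli composition. The functor $F_A$ sends $(X,\theta)$ to $\mathcal M_{\Bbbk}(X)$ with action $a\cdot v=\Phi_X(\theta(a))v$, and sends $f$ to the linear map $[x]\mapsto f(x)$; it is a $\Bbbk$-linear equivalence. An object $(X,\theta)$ is a projective Kleisli convolution representation if $F_A(X,\theta)$ is a projective left $A$-module. *)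

(* Defs.v *)
From HB Require Import structures.
From mathcomp Require Import all_boot all_order all_algebra.
From mathcomp Require Import boolp.
From mathcomp Require Import finmap monalg.

Set Implicit Arguments.
Unset Strict Implicit.
Unset Printing Implicit Defensive.

Import GRing.Theory.
Local Open Scope ring_scope.

(* A k-algebra is a ring with a central structure morphism from k; the scalar *)
(* action is c . a = kalg_str c * a.  MathComp's algType and falgType exclude   *)
(* the zero ring, which has to be allowed: it is H k X below for X empty.       *)
Record kalgebra (k : fieldType) := KAlgebra {
  kalg_ring :> pzRingType;
  kalg_str : {rmorphism k -> kalg_ring};
  kalg_central : forall c a, kalg_str c * a = a * kalg_str c
}.

Record kalg_hom (k : fieldType) (A B : kalgebra k) := KAlgHom {
  kalg_fun :> {rmorphism A -> B};
  kalg_funP : forall c : k, kalg_fun (kalg_str A c) = kalg_str B c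
}.

Definition finite_dim (k : fieldType) (V : lmodType k) : Prop :=
  exists (n : nat) (e : 'I_n -> V),
    forall v : V, exists c : 'I_n -> k, v = \sum_i c i *: e i.

Record lincat (k : fieldType) := LinCat {
  ob :> Type;
  hom : ob -> ob -> lmodType k;
  idc : forall x, hom x x;
  comp : forall x y z, hom y z -> hom x y -> hom x z;
  compA : forall x y z t (h : hom z t) (g : hom y z) (f : hom x y),
    comp h (comp g f) = comp (comp h g) f;
  comp1c : forall x y (f : hom x y), comp (idc y) f = f;
  compc1 : forall x y (f : hom x y), comp f (idc x) = f;
  comp_linl : forall x y z (f : hom x y), linear (fun g : hom y z => comp g f);
  comp_linr : forall x y z (g : hom y z), linear (fun f : hom x y => comp g f)
}.

Record linfunctor (k : fieldType) (C D : lincat k) := LinFunctor {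
  fob :> C -> D;
  fhom : forall x y, hom x y -> hom (fob x) (fob y);
  fhom_lin : forall x y, linear (@fhom x y);
  fhom1 : forall x, fhom (idc x) = idc (fob x);
  fhomM : forall x y z (g : hom y z) (f : hom x y),
    fhom (comp g f) = comp (fhom g) (fhom f)
}.

Section Functors.
Variable k : fieldType.

Definition idfunctor (C : lincat k) : linfunctor C C.
Proof. by exists (fun x => x) (fun x y f => f). Defined.

Definition compfunctor (C D E : lincat k)
  (G : linfunctor D E) (F : linfunctor C D) : linfunctor C E.
Proof.
exists (fun x => G (F x)) (fun x y f => fhom G (fhom F f)).
- by move=> x y c f g; rewrite !fhom_lin.
- by move=> x; rewrite !fhom1.
- by move=> x y z g f; rewrite !fhomM.
Defined.

Definition isiso (C : lincat k) (x y : C) (f : hom x y) : Prop :=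
  exists g : hom y x, comp g f = idc x /\ comp f g = idc y.

Definition natiso (C D : lincat k) (F G : linfunctor C D) : Prop :=
  exists a : forall x, hom (F x) (G x),
    (forall x, isiso (a x)) /\
    (forall x y (f : hom x y), comp (a y) (fhom F f) = comp (fhom G f) (a x)).

(* The quasi-inverse is asked to be k-linear, which is automatic for a       *)
(* quasi-inverse of a k-linear functor.                                      *)
Definition is_equivalence (C D : lincat k) (F : linfunctor C D) : Prop :=
  exists G : linfunctor D C,
    natiso (compfunctor G F) (idfunctor C) /\
    natiso (compfunctor F G) (idfunctor D).

Definition fullsub (C : lincat k) (P : C -> Prop) : lincat k.
Proof.
exists {x : C | P x} (fun x y => hom (sval x) (sval y)) (fun x => idc (sval x))
       (fun x y z g f => comp g f).
- by move=> *; exact: compA.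
- by move=> *; exact: comp1c.
- by move=> *; exact: compc1.
- by move=> *; exact: comp_linl.
- by move=> *; exact: comp_linr.
Defined.

Definition frestrict (C D : lincat k) (F : linfunctor C D)
  (P : C -> Prop) (Q : D -> Prop) (PQ : forall x, P x -> Q (F x)) :
  linfunctor (fullsub P) (fullsub Q).
Proof.
exists (fun x : fullsub P => exist Q (F (sval x)) (PQ _ (svalP x)) : fullsub Q)
       (fun x y f => fhom F f).
- by move=> x y; exact: (fhom_lin F (x := sval x) (y := sval y)).
- by move=> x; exact: fhom1.
- by move=> x y z g f; exact: fhomM.
Defined.

End Functors.

Section Rep.
Variables (k : fieldType) (A : kalgebra k).

(* The k-vector space underlying a left A-module, with c . m = (c . 1_A) m. *)
Definition kspace (M : lmodType A) : Type := M.

Section KSpace.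
Variable M : lmodType A.
Let kscale (c : k) (m : kspace M) : kspace M := kalg_str A c *: (m : M).

HB.instance Definition _ := GRing.Zmodule.on (kspace M).

Fact kscalerA (c d : k) (m : kspace M) :
  kscale c (kscale d m) = kscale (c * d) m.
Proof. by rewrite /kscale [LHS]scalerA rmorphM. Qed.
Fact kscale1r : left_id 1 kscale.
Proof. by move=> m; rewrite /kscale rmorph1 [LHS]scale1r. Qed.
Fact kscalerDr : right_distributive kscale +%R.
Proof. by move=> c m n; rewrite /kscale [LHS]scalerDr. Qed.
Fact kscalerDl (m : kspace M) : {morph kscale^~ m : c d / c + d}.
Proof. by move=> c d; rewrite /kscale rmorphD [LHS]scalerDl. Qed.

HB.instance Definition _ := GRing.Zmodule_isLmodule.Build k (kspace M)
  kscalerA kscale1r kscalerDr kscalerDl.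

Lemma kscaleE (c : k) (m : kspace M) :
  c *: m = (kalg_str A c *: (m : M) : M).
Proof. by []. Qed.
End KSpace.

Definition finite_dim_alg : Prop := finite_dim (kspace A^o).

Definition projective (P : lmodType A) : Prop :=
  forall (M N : lmodType A) (g : {linear M -> N}) (f : {linear P -> N}),
    (forall n, exists m, g m = n) ->
    exists h : {linear P -> M}, forall p, g (h p) = f p.

Record repob := RepOb {
  repmod :> lmodType A;
  rep_fin : finite_dim (kspace repmod)
}.

Definition rephom (M N : lmodType A) : Type := {linear M -> N}.

Section RepHom.
Variables M N : lmodType A.
Implicit Types f g : rephom M N.

Definition rephom_fun (f : rephom M N) : M -> N := (f : {linear M -> N}).

Lemma rephomP f g : rephom_fun f =1 rephom_fun g -> f = g.
Proof.
rewrite /rephom_fun.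
case: f => f [[fD] [fZ]]; case: g => g [[gD] [gZ]] /= /funext fg.
by subst g; rewrite (Prop_irrelevance fD gD) (Prop_irrelevance fZ gZ).
Qed.

Definition mkrephom (f : M -> N) (lf : linear f) : rephom M N :=
  HB.pack f (GRing.isLinear.Build A M N *:%R f lf).

Fact rh0_lin : linear (fun _ : M => 0 : N).
Proof. by move=> a m n; rewrite scaler0 addr0. Qed.
Fact rhN_lin f : linear (fun m => - rephom_fun f m).
Proof. by move=> a m n; rewrite /rephom_fun linearP opprD scalerN. Qed.
Fact rhD_lin f g : linear (fun m => rephom_fun f m + rephom_fun g m).
Proof. by move=> a m n; rewrite /rephom_fun !linearP scalerDr addrACA. Qed.
Fact rhZ_lin (c : k) f :
  linear (fun m => c *: (rephom_fun f m : kspace N) : N).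
Proof.
move=> a m n; rewrite /rephom_fun linearP !kscaleE scalerDr !scalerA.
by rewrite kalg_central.
Qed.

Definition rh0 := mkrephom rh0_lin.
Definition rhN f := mkrephom (rhN_lin f).
Definition rhD f g := mkrephom (rhD_lin f g).
Definition rhZ c f := mkrephom (rhZ_lin c f).

Fact rhDA : associative rhD.
Proof. by move=> f g h; apply: rephomP => m /=; exact: addrA. Qed.
Fact rhDC : commutative rhD.
Proof. by move=> f g; apply: rephomP => m /=; exact: addrC. Qed.
Fact rhD0 : left_id rh0 rhD.
Proof. by move=> f; apply: rephomP => m /=; exact: add0r. Qed.
Fact rhDN : left_inverse rh0 rhN rhD.
Proof. by move=> f; apply: rephomP => m /=; exact: addNr. Qed.

HB.instance Definition _ := gen_eqMixin (rephom M N).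
HB.instance Definition _ := gen_choiceMixin (rephom M N).
HB.instance Definition _ :=
  GRing.isZmodule.Build (rephom M N) rhDA rhDC rhD0 rhDN.

Fact rhZA (c d : k) f : rhZ c (rhZ d f) = rhZ (c * d) f.
Proof. by apply: rephomP => m; exact: (scalerA c d (_ : kspace N)). Qed.
Fact rhZ1 : left_id 1 rhZ.
Proof. by move=> f; apply: rephomP => m; exact: (scale1r (_ : kspace N)). Qed.
Fact rhZDr : right_distributive rhZ +%R.
Proof.
by move=> c f g; apply: rephomP => m; exact: (scalerDr c (_ : kspace N)).
Qed.
Fact rhZDl f : {morph rhZ^~ f : c d / c + d}.
Proof.
by move=> c d; apply: rephomP => m; exact: (scalerDl (_ : kspace N)).
Qed.

HB.instance Definition _ :=
  GRing.Zmodule_isLmodule.Build k (rephom M N) rhZA rhZ1 rhZDr rhZDl.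
End RepHom.

Definition rep1 (M : lmodType A) : rephom M M := (idfun : {linear M -> M}).
Definition repcomp (M N P : lmodType A) (g : rephom N P) (f : rephom M N) :
  rephom M P := (rephom_fun g \o rephom_fun f : {linear M -> P}).

Definition rep : lincat k.
Proof.
exists repob (fun M N => rephom M N) (fun M => rep1 M)
       (fun M N P g f => repcomp g f).
- by move=> M N P Q h g f; apply: rephomP.
- by move=> M N f; apply: rephomP.
- by move=> M N f; apply: rephomP.
- by move=> M N P f c g g'; apply: rephomP.
- move=> M N P g c f f'; apply: rephomP => m.
  rewrite /rephom_fun /= [LHS]linearD; congr (_ + _); exact: linearZ.
Defined.

Definition proj : lincat k :=
  @fullsub k rep (fun M : repob => projective M).

End Rep.

(* {malg k[X]} is the free k-module on X, realized by finitely supported      *)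
(* functions: << x >> is the generator [x], and v@_x is the coefficient of [x]. *)
Section FreeModule.
Variable k : fieldType.

Definition kunit (X : choiceType) (x : X) : {malg k[X]} := << x >>.

Definition kbind (X Y : choiceType) (f : X -> {malg k[Y]}) (v : {malg k[X]}) :
  {malg k[Y]} := \sum_(x <- msupp v) v@_x *: f x.

Definition kcomp (X Y Z : choiceType)
  (h : Y -> {malg k[Z]}) (f : X -> {malg k[Y]}) : X -> {malg k[Z]} :=
  fun x => kbind h (f x).

(* MathComp matrices are indexed by ordinals; a finite set X indexes rows and *)
(* columns through enum_val : 'I_#|X| -> X.                                   *)
Definition kmx (X Y : finType) (f : X -> {malg k[Y]}) : 'M[k]_(#|Y|, #|X|) :=
  \matrix_(i, j) (f (enum_val j))@_(enum_val i).

Definition colM (X : finType) (v : {malg k[X]}) : 'cV[k]_#|X| :=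
  \col_i v@_(enum_val i).
Definition Mcol (X : finType) (w : 'cV[k]_#|X|) : {malg k[X]} :=
  \sum_i w i 0 *: << enum_val i >>.

Lemma malgE (X : finType) (v : {malg k[X]}) :
  v = \sum_x v@_x *: << x >>.
Proof.
apply/malgP => y; rewrite raddf_sum (bigD1 y) //= mcoeffZ mcoeffU eqxx mulr1.
rewrite big1 ?addr0 // => x xy.
by rewrite mcoeffZ mcoeffU (negbTE xy) mulr0.
Qed.

Lemma colMK (X : finType) : cancel (@colM X) (@Mcol X).
Proof.
move=> v; rewrite [RHS]malgE (reindex (@enum_val X predT)) /=; last first.
  exact/onW_bij/enum_val_bij.
by apply: eq_bigr => i _; rewrite mxE.
Qed.

Lemma McolK (X : finType) : cancel (@Mcol X) (@colM X).
Proof.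
move=> w; apply/colP => i; rewrite mxE raddf_sum (bigD1 i) //= mcoeffZ mcoeffU.
rewrite eqxx mulr1 big1 ?addr0 // => j ji.
by rewrite mcoeffZ mcoeffU (inj_eq enum_val_inj) (negbTE ji) mulr0.
Qed.

Fact colM_lin (X : finType) : linear (@colM X).
Proof. by move=> c v w; apply/colP => i; rewrite !mxE mcoeffD mcoeffZ. Qed.
HB.instance Definition _ (X : finType) :=
  GRing.isLinear.Build k {malg k[X]} 'cV[k]_#|X| *:%R (@colM X) (@colM_lin X).

Fact Mcol_lin (X : finType) : linear (@Mcol X).
Proof.
move=> c v w; rewrite /Mcol scaler_sumr -big_split /=.
by apply: eq_bigr => i _; rewrite !mxE scalerA -scalerDl.
Qed.
HB.instance Definition _ (X : finType) :=
  GRing.isLinear.Build k 'cV[k]_#|X| {malg k[X]} *:%R (@Mcol X) (@Mcol_lin X).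

Lemma kbindE (X : finType) (Y : choiceType) (f : X -> {malg k[Y]}) v :
  kbind f v = \sum_x v@_x *: f x.
Proof.
rewrite /kbind; apply/esym.
rewrite (bigID (fun x => x \in msupp v)) /= [X in _ + X]big1 ?addr0; last first.
  by move=> x /mcoeff_outdom ->; rewrite scale0r.
rewrite -big_filter; apply: perm_big; apply: uniq_perm.
- exact/filter_uniq/index_enum_uniq.
- exact: fset_uniq.
- by move=> x; rewrite mem_filter mem_index_enum andbT.
Qed.

Fact kbind_lin (X : finType) (Y : choiceType) (f : X -> {malg k[Y]}) :
  linear (kbind f).
Proof.
move=> c v w; rewrite !kbindE scaler_sumr -big_split /=; apply: eq_bigr => x _.
by rewrite mcoeffD mcoeffZ scalerDl scalerA.
Qed.
HB.instance Definition _ (X : finType) (Y : choiceType) f :=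
  GRing.isLinear.Build k {malg k[X]} {malg k[Y]} *:%R (@kbind X Y f)
    (kbind_lin f).

Lemma colM_kbind (X Y : finType) (f : X -> {malg k[Y]}) v :
  colM (kbind f v) = kmx f *m colM v.
Proof.
apply/colP => i; rewrite !mxE kbindE raddf_sum /=.
rewrite (reindex (@enum_val X predT)) /=; last exact/onW_bij/enum_val_bij.
by apply: eq_bigr => j _; rewrite !mxE mcoeffZ mulrC.
Qed.

Lemma kmx_comp (X Y Z : finType)
    (h : Y -> {malg k[Z]}) (f : X -> {malg k[Y]}) :
  kmx (kcomp h f) = kmx h *m kmx f.
Proof.
apply/matrixP => i j.
have := congr1 (fun w : 'cV_ _ => w i 0) (colM_kbind h (f (enum_val j))).
rewrite !mxE => ->; apply: eq_bigr => l _; by rewrite !mxE.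
Qed.

Lemma kmx_inj (X Y : finType) (f g : X -> {malg k[Y]}) :
  kmx f = kmx g -> f = g.
Proof.
move=> /matrixP fg; apply/funext => x; apply/malgP => y.
by have := fg (enum_rank y) (enum_rank x); rewrite !mxE !enum_rankK.
Qed.

Lemma kmx1 (X : finType) : kmx (@kunit X) = 1%:M.
Proof.
apply/matrixP => i j.
by rewrite !mxE mcoeffU (inj_eq enum_val_inj) eq_sym.
Qed.

End FreeModule.

Section Convolution.
Variables (k : fieldType) (X : finType).

Definition H : Type := unit -> {malg k[(X * X)%type]}.
Implicit Types f g h : H.

Definition hcoef f (i j : X) : k := (f tt)@_(i, j).

Definition h0 : H := fun=> 0.
Definition hopp f : H := fun t => - f t.
Definition hadd f g : H := fun t => f t + g t.
Definition hscale (c : k) f : H := fun t => c *: f t.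
Definition hone : H := fun=> \sum_x << (x, x) >>.
Definition hmul f g : H :=
  fun=> \sum_i \sum_q (\sum_j hcoef f i j * hcoef g j q) *: << (i, q) >>.

Definition Phi f : 'M[k]_#|X| := \matrix_(i, j) hcoef f (enum_val i) (enum_val j).

Lemma HP f g : hcoef f =2 hcoef g -> f = g.
Proof. by move=> fg; apply/funext => -[]; apply/malgP => -[i j]; exact: fg. Qed.

Lemma hcoef1 i j : hcoef hone i j = (i == j)%:R.
Proof.
rewrite /hcoef /hone raddf_sum /= (bigD1 i) //= mcoeffU big1 ?addr0.
  by rewrite xpair_eqE eqxx.
by move=> x xi; rewrite mcoeffU xpair_eqE (negbTE xi).
Qed.

Lemma hcoefM f g i q : hcoef (hmul f g) i q = \sum_j hcoef f i j * hcoef g j q.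
Proof.
rewrite {1}/hcoef /hmul pair_big /= raddf_sum /= (bigD1 (i, q)) //=.
rewrite mcoeffZ mcoeffU eqxx mulr1 [X in _ + X]big1 ?addr0 // => -[a b] /= ab.
by rewrite mcoeffZ mcoeffU (negbTE ab) mulr0.
Qed.

Lemma Phi_inj : injective Phi.
Proof.
move=> f g /matrixP fg; apply: HP => i j.
by have := fg (enum_rank i) (enum_rank j); rewrite !mxE !enum_rankK.
Qed.

Lemma Phi0 : Phi h0 = 0.
Proof. by apply/matrixP => i j; rewrite !mxE /hcoef mcoeff0. Qed.
Lemma PhiN f : Phi (hopp f) = - Phi f.
Proof. by apply/matrixP => i j; rewrite !mxE /hcoef mcoeffN. Qed.
Lemma PhiD f g : Phi (hadd f g) = Phi f + Phi g.
Proof. by apply/matrixP => i j; rewrite !mxE /hcoef mcoeffD. Qed.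
Lemma PhiZ c f : Phi (hscale c f) = c *: Phi f.
Proof. by apply/matrixP => i j; rewrite !mxE /hcoef mcoeffZ. Qed.
Lemma Phi1 : Phi hone = 1%:M.
Proof.
by apply/matrixP => i j; rewrite !mxE hcoef1 (inj_eq enum_val_inj).
Qed.
Lemma PhiM f g : Phi (hmul f g) = Phi f *m Phi g.
Proof.
apply/matrixP => i j; rewrite !mxE hcoefM (reindex (@enum_val X predT)) /=.
  by apply: eq_bigr => l _; rewrite !mxE.
exact/onW_bij/enum_val_bij.
Qed.

Fact haddA : associative hadd.
Proof. by move=> f g h; apply: Phi_inj; rewrite !PhiD addrA. Qed.
Fact haddC : commutative hadd.
Proof. by move=> f g; apply: Phi_inj; rewrite !PhiD addrC. Qed.
Fact hadd0 : left_id h0 hadd.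
Proof. by move=> f; apply: Phi_inj; rewrite PhiD Phi0 add0r. Qed.
Fact haddN : left_inverse h0 hopp hadd.
Proof. by move=> f; apply: Phi_inj; rewrite PhiD PhiN Phi0 addNr. Qed.

HB.instance Definition _ := gen_eqMixin H.
HB.instance Definition _ := gen_choiceMixin H.
HB.instance Definition _ := GRing.isZmodule.Build H haddA haddC hadd0 haddN.

Fact hmulA : associative hmul.
Proof. by move=> f g h; apply: Phi_inj; rewrite !PhiM mulmxA. Qed.
Fact hmul1f : left_id hone hmul.
Proof. by move=> f; apply: Phi_inj; rewrite PhiM Phi1 mul1mx. Qed.
Fact hmulf1 : right_id hone hmul.
Proof. by move=> f; apply: Phi_inj; rewrite PhiM Phi1 mulmx1. Qed.
Fact hmulDl : left_distributive hmul +%R.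
Proof.
by move=> f g h; apply: Phi_inj; rewrite PhiM !PhiD !PhiM mulmxDl.
Qed.
Fact hmulDr : right_distributive hmul +%R.
Proof.
by move=> f g h; apply: Phi_inj; rewrite PhiM !PhiD !PhiM mulmxDr.
Qed.

HB.instance Definition _ :=
  GRing.Zmodule_isPzRing.Build H hmulA hmul1f hmulf1 hmulDl hmulDr.

Fact hscaleA (c d : k) f : hscale c (hscale d f) = hscale (c * d) f.
Proof. by apply: Phi_inj; rewrite !PhiZ scalerA. Qed.
Fact hscale1 : left_id 1 hscale.
Proof. by move=> f; apply: Phi_inj; rewrite PhiZ scale1r. Qed.
Fact hscaleDr : right_distributive hscale +%R.
Proof. by move=> c f g; apply: Phi_inj; rewrite PhiZ !PhiD !PhiZ scalerDr. Qed.
Fact hscaleDl f : {morph hscale^~ f : c d / c + d}.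
Proof. by move=> c d; apply: Phi_inj; rewrite PhiZ !PhiD !PhiZ scalerDl. Qed.

HB.instance Definition _ :=
  GRing.Zmodule_isLmodule.Build k H hscaleA hscale1 hscaleDr hscaleDl.

(* By hstr_mul, multiplication by hstr c is the pointwise scaling by c. *)
Definition hstr (c : k) : H := c *: (1 : H).

Fact hstr_zmod : zmod_morphism hstr.
Proof. by move=> c d; rewrite /hstr scalerBl. Qed.
Fact hstr_monoid : monoid_morphism hstr.
Proof.
split=> [|c d]; first by rewrite /hstr scale1r.
apply: Phi_inj; rewrite /hstr PhiM !PhiZ Phi1.
by rewrite -!scalemxAl mul1mx scalerA.
Qed.
HB.instance Definition _ := GRing.isZmodMorphism.Build k H hstr hstr_zmod.
HB.instance Definition _ := GRing.isMonoidMorphism.Build k H hstr hstr_monoid.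

Lemma hstr_mul (c : k) f : hstr c * f = c *: f.
Proof.
by apply: Phi_inj; rewrite PhiM !PhiZ Phi1 -scalemxAl mul1mx.
Qed.

Fact hstr_central (c : k) f : hstr c * f = f * hstr c.
Proof.
rewrite hstr_mul; apply: Phi_inj.
by rewrite PhiM !PhiZ Phi1 -scalemxAr mulmx1.
Qed.

Definition Halg : kalgebra k := @KAlgebra k H hstr hstr_central.

End Convolution.

Section Klcrep.
Variables (k : fieldType) (A : kalgebra k).

Record klcob := KlcOb {
  klset : finType;
  kltheta : kalg_hom A (Halg k klset)
}.

Definition klmx (R : klcob) (a : A) : 'M[k]_#|klset R| := Phi (kltheta R a).

Record klchom (R S : klcob) := KlcHom {
  klarr : klset R -> {malg k[klset S]};
  klarrP : forall a, klmx S a *m kmx klarr = kmx klarr *m klmx R a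
}.

Section KlcHomSpace.
Variables R S : klcob.
Implicit Types f g : klchom R S.

Lemma klchomP f g : klarr f = klarr g -> f = g.
Proof.
case: f g => f fP [g gP] /= fg; subst g.
by rewrite (Prop_irrelevance fP gP).
Qed.

Fact kl0P a : klmx S a *m kmx (fun=> 0 : {malg k[klset S]})
  = kmx (fun=> 0) *m klmx R a.
Proof.
have -> : kmx (fun _ : klset R => 0 : {malg k[klset S]}) = 0.
  by apply/matrixP => i j; rewrite !mxE mcoeff0.
by rewrite mulmx0 mul0mx.
Qed.
Definition kl0 : klchom R S := KlcHom kl0P.

Fact klNP f a : klmx S a *m kmx (fun x => - klarr f x)
  = kmx (fun x => - klarr f x) *m klmx R a.
Proof.
have -> : kmx (fun x => - klarr f x) = - kmx (klarr f).
  by apply/matrixP => i j; rewrite !mxE mcoeffN.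
by rewrite mulmxN mulNmx klarrP.
Qed.
Definition klN f : klchom R S := KlcHom (klNP f).

Fact klDP f g a : klmx S a *m kmx (fun x => klarr f x + klarr g x)
  = kmx (fun x => klarr f x + klarr g x) *m klmx R a.
Proof.
have -> : kmx (fun x => klarr f x + klarr g x) = kmx (klarr f) + kmx (klarr g).
  by apply/matrixP => i j; rewrite !mxE mcoeffD.
by rewrite mulmxDr mulmxDl !klarrP.
Qed.
Definition klD f g : klchom R S := KlcHom (klDP f g).

Fact klZP (c : k) f a : klmx S a *m kmx (fun x => c *: klarr f x)
  = kmx (fun x => c *: klarr f x) *m klmx R a.
Proof.
have -> : kmx (fun x => c *: klarr f x) = c *: kmx (klarr f).
  by apply/matrixP => i j; rewrite !mxE mcoeffZ.
by rewrite -scalemxAr -scalemxAl klarrP.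
Qed.
Definition klZ c f : klchom R S := KlcHom (klZP c f).

Fact klDA : associative klD.
Proof. by move=> f g h; apply/klchomP/funext => x /=; rewrite addrA. Qed.
Fact klDC : commutative klD.
Proof. by move=> f g; apply/klchomP/funext => x /=; rewrite addrC. Qed.
Fact klD0 : left_id kl0 klD.
Proof. by move=> f; apply/klchomP/funext => x /=; rewrite add0r. Qed.
Fact klDN : left_inverse kl0 klN klD.
Proof. by move=> f; apply/klchomP/funext => x /=; rewrite addNr. Qed.

HB.instance Definition _ := gen_eqMixin (klchom R S).
HB.instance Definition _ := gen_choiceMixin (klchom R S).
HB.instance Definition _ :=
  GRing.isZmodule.Build (klchom R S) klDA klDC klD0 klDN.

Fact klZA (c d : k) f : klZ c (klZ d f) = klZ (c * d) f.
Proof. by apply/klchomP/funext => x /=; rewrite scalerA. Qed.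
Fact klZ1 : left_id 1 klZ.
Proof. by move=> f; apply/klchomP/funext => x /=; rewrite scale1r. Qed.
Fact klZDr : right_distributive klZ +%R.
Proof. by move=> c f g; apply/klchomP/funext => x /=; rewrite scalerDr. Qed.
Fact klZDl f : {morph klZ^~ f : c d / c + d}.
Proof. by move=> c d; apply/klchomP/funext => x /=; rewrite scalerDl. Qed.

HB.instance Definition _ :=
  GRing.Zmodule_isLmodule.Build k (klchom R S) klZA klZ1 klZDr klZDl.
End KlcHomSpace.

Fact kl1P (R : klcob) a :
  klmx R a *m kmx (@kunit k (klset R)) = kmx (@kunit k (klset R)) *m klmx R a.
Proof. by rewrite kmx1 mulmx1 mul1mx. Qed.
Definition kl1 (R : klcob) : klchom R R := KlcHom (@kl1P R).

Fact klcompP (R S T : klcob) (g : klchom S T) (f : klchom R S) a :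
  klmx T a *m kmx (kcomp (klarr g) (klarr f))
  = kmx (kcomp (klarr g) (klarr f)) *m klmx R a.
Proof. by rewrite kmx_comp mulmxA klarrP -mulmxA klarrP mulmxA. Qed.
Definition klcomp (R S T : klcob) (g : klchom S T) (f : klchom R S) :
  klchom R T := KlcHom (klcompP g f).

Definition Klcrep : lincat k.
Proof.
exists klcob (fun R S => klchom R S) kl1 klcomp.
- move=> R S T U h g f; apply/klchomP/kmx_inj => /=.
  by rewrite !kmx_comp mulmxA.
- by move=> R S f; apply/klchomP/kmx_inj; rewrite /= kmx_comp kmx1 mul1mx.
- by move=> R S f; apply/klchomP/kmx_inj; rewrite /= kmx_comp kmx1 mulmx1.
- move=> R S T f c g g'; apply/klchomP/funext => x; rewrite /= /kcomp !kbindE.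
  rewrite scaler_sumr -big_split; apply: eq_bigr => y _ /=.
  by rewrite scalerDr !scalerA mulrC.
- move=> R S T g c f f'; apply/klchomP/funext => x.
  by rewrite /= /kcomp linearP.
Defined.

(* The carrier is already a k-module; Fmod_kscaleE shows that the k-structure *)
(* induced by the A-action below is the same one.                             *)
Definition Fmod (R : klcob) : Type := {malg k[klset R]}.

Section FmodModule.
Variable R : klcob.

Definition Fscale (a : A) (v : Fmod R) : Fmod R := Mcol (klmx R a *m colM v).

HB.instance Definition _ := GRing.Zmodule.on (Fmod R).

Lemma klmxD a b : klmx R (a + b) = klmx R a + klmx R b.
Proof. by rewrite /klmx rmorphD; exact: PhiD. Qed.
Lemma klmxM a b : klmx R (a * b) = klmx R a *m klmx R b.
Proof. by rewrite /klmx rmorphM; exact: PhiM. Qed.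
Lemma klmx1 : klmx R 1 = 1%:M.
Proof. by rewrite /klmx rmorph1; exact: Phi1. Qed.
Lemma klmx_str c : klmx R (kalg_str A c) = c%:M.
Proof.
by rewrite /klmx kalg_funP -scalemx1 -(Phi1 k (klset R)) -PhiZ.
Qed.

Fact FscaleA a b v : Fscale a (Fscale b v) = Fscale (a * b) v.
Proof. by rewrite /Fscale McolK klmxM mulmxA. Qed.
Fact Fscale1 : left_id 1 Fscale.
Proof. by move=> v; rewrite /Fscale klmx1 mul1mx colMK. Qed.
Fact FscaleDr : right_distributive Fscale +%R.
Proof.
move=> a v w; rewrite /Fscale.
by rewrite [colM _](raddfD (@colM k (klset R))) mulmxDr raddfD.
Qed.
Fact FscaleDl v : {morph Fscale^~ v : a b / a + b}.
Proof. by move=> a b; rewrite /Fscale klmxD mulmxDl raddfD. Qed.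

HB.instance Definition _ :=
  GRing.Zmodule_isLmodule.Build A (Fmod R) FscaleA Fscale1 FscaleDr FscaleDl.

Lemma Fmod_scaleE (a : A) (v : Fmod R) :
  a *: v = Mcol (Phi (kltheta R a) *m colM v).
Proof. by []. Qed.

Lemma Fmod_kscaleE (c : k) (v : {malg k[klset R]}) :
  c *: (v : kspace (Fmod R)) = c *: v.
Proof.
rewrite kscaleE [LHS]/(Fscale _ _) /Fscale klmx_str.
by rewrite mul_scalar_mx linearZ /= colMK.
Qed.

Fact Fmod_fin : finite_dim (kspace (Fmod R)).
Proof.
exists #|klset R|, (fun i => << enum_val i >> : {malg k[klset R]}) => v.
exists (fun i => colM v i 0); rewrite -[LHS](@colMK k (klset R)) /Mcol.
by apply: eq_bigr => i _; rewrite Fmod_kscaleE.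
Qed.
End FmodModule.

Definition Fob (R : klcob) : repob A := RepOb (Fmod_fin R).

Fact Fhom_lin (R S : klcob) (f : klchom R S) :
  linear (kbind (klarr f) : Fmod R -> Fmod S).
Proof.
move=> a v w; rewrite [LHS]raddfD; congr (_ + _).
apply: (can_inj (@colMK k (klset S))).
by rewrite colM_kbind !McolK colM_kbind !mulmxA klarrP.
Qed.
Definition Fhom (R S : klcob) (f : klchom R S) : rephom (Fmod R) (Fmod S) :=
  mkrephom (@Fhom_lin R S f).

Definition FA : linfunctor Klcrep (rep A).
Proof.
exists Fob Fhom.
- move=> R S c f g; apply: rephomP => v.
  rewrite [LHS]kbindE; apply/esym.
  rewrite [LHS](_ : _ = c *: kbind (klarr f) v + kbind (klarr g) v); last first.
    by congr (_ + _); exact: Fmod_kscaleE.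
  rewrite !kbindE scaler_sumr -big_split; apply: eq_bigr => x _ /=.
  by rewrite scalerDr !scalerA mulrC.
- move=> R; apply: rephomP => v.
  by rewrite [LHS]kbindE -malgE.
- move=> R S T g f; apply: rephomP => v.
  apply: (can_inj (@colMK k (klset T))).
  rewrite [LHS]colM_kbind kmx_comp [RHS]colM_kbind.
  by rewrite [X in _ = _ *m X]colM_kbind mulmxA.
Defined.

Definition projective_klc (R : Klcrep) : Prop := projective (Fmod R).

Definition Klcrep_proj : lincat k := fullsub projective_klc.

Definition FA_proj : linfunctor Klcrep_proj (proj A) :=
  @frestrict k Klcrep (rep A) FA projective_klc
    (fun M : repob A => projective M) (fun R PR => PR).

End Klcrep.

(* Main.v *)
From HB Require Import structures.
From mathcomp Require Import all_boot all_order all_algebra.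
From mathcomp Require Import boolp monalg.
Require Import Defs.

(** A linear functor that is bijective on hom spaces and hits every object up
    to isomorphism is an equivalence, and both properties pass to full
    subcategories cut out by an isomorphism-invariant property [Q] of the target
    and its inverse image in the source.  Being a projective module is invariant
    under isomorphism, and a Kleisli convolution representation is projective
    exactly when its image under [FA] is; so everything reduces to [FA] itself.

    [FA] is bijective on hom spaces ([FA_fully_faithful]) because a k-linear map
    out of a free module is the extension of its values on generators, and, read
    on matrices, commuting with all operators of A is the condition defining a
    morphism of Kleisli convolution representations.

    [FA] hits every module M up to isomorphism ([FA_ess_surj]): discarding
    redundant vectors from a finite spanning family of M leaves a basis, hence a
    k-linear bijection from the free module on a finite set onto M; transporting
    the operators of A along it and reading off their matrices gives an algebra
    morphism to the convolution algebra. *)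

Set Implicit Arguments.
Unset Strict Implicit.
Unset Printing Implicit Defensive.

Import GRing.Theory.
Local Open Scope ring_scope.

(** * Equivalences of linear categories *)

Section Equivalence.
Variable k : fieldType.

Definition fully_faithful (C D : lincat k) (F : linfunctor C D) : Prop :=
  forall x y : C, injective (@fhom k C D F x y) /\
    (forall g : hom (F x) (F y), exists f : hom x y, fhom F f = g).

Definition isomorphic (C : lincat k) (x y : C) : Prop :=
  exists f : hom x y, isiso f.

Definition ess_surj (C D : lincat k) (F : linfunctor C D) : Prop :=
  forall z : D, exists x : C, isomorphic (F x) z.

(** The quasi-inverse picks, for each object [z], some [o z] with an isomorphism
    [a z : F (o z) -> z]; a morphism is conjugated by these isomorphisms and
    lifted along [F].  All its laws hold after applying the injective [fhom F],
    where the isomorphisms cancel. *)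
Theorem fully_faithful_equivalence (C D : lincat k) (F : linfunctor C D) :
  fully_faithful F -> ess_surj F -> is_equivalence F.
Proof.
move=> ffF essF.
pose o z := sval (cid (essF z)).
pose a z : hom (F (o z)) z := sval (cid (svalP (cid (essF z)))).
have a_iso z : isiso (a z) := svalP (cid (svalP (cid (essF z)))).
pose b z : hom z (F (o z)) := sval (cid (a_iso z)).
have baK z : comp (b z) (a z) = idc (F (o z)) := (svalP (cid (a_iso z))).1.
have abK z : comp (a z) (b z) = idc z := (svalP (cid (a_iso z))).2.
have inj x y : injective (@fhom k C D F x y) := (ffF x y).1.
pose pre x y (g : hom (F x) (F y)) : hom x y := sval (cid ((ffF x y).2 g)).
have preK x y (g : hom (F x) (F y)) : fhom F (pre x y g) = g
  := svalP (cid ((ffF x y).2 g)).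
pose Gh z t (f : hom z t) : hom (o z) (o t) :=
  pre _ _ (comp (b t) (comp f (a z))).
have GhE z t (f : hom z t) : fhom F (Gh z t f) = comp (b t) (comp f (a z)).
  exact: preK.
have Gh_lin z t : linear (Gh z t).
  move=> c f g; apply: inj; rewrite fhom_lin !GhE.
  by rewrite comp_linl comp_linr.
have Gh1 z : Gh z z (idc z) = idc (o z).
  by apply: inj; rewrite GhE comp1c baK fhom1.
have GhM x y z (g : hom y z) (f : hom x y) :
    Gh x z (comp g f) = comp (Gh y z g) (Gh x y f).
  apply: inj; rewrite fhomM !GhE -!compA; congr (comp _ (comp _ _)).
  by rewrite [RHS]compA abK comp1c.
have a_nat z t (f : hom z t) : comp (a t) (fhom F (Gh z t f)) = comp f (a z).
  by rewrite GhE compA abK comp1c.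
exists (LinFunctor Gh_lin Gh1 GhM); split.
- exists (fun x => pre _ _ (a (F x))); split=> [x|x y f].
    exists (pre _ _ (b (F x))); split; apply: inj.
      by rewrite fhomM !preK fhom1 baK.
    by rewrite fhomM !preK fhom1 abK.
  by apply: inj; rewrite [RHS]fhomM [LHS]fhomM !preK -[RHS]a_nat GhE.
- by exists a.
Qed.

Lemma fully_faithful_restrict (C D : lincat k) (F : linfunctor C D)
    (P : C -> Prop) (Q : D -> Prop) (PQ : forall x, P x -> Q (F x)) :
  fully_faithful F -> fully_faithful (frestrict PQ).
Proof. by move=> ffF x y; exact: ffF (sval x) (sval y). Qed.

Lemma ess_surj_restrict (C D : lincat k) (F : linfunctor C D)
    (P : C -> Prop) (Q : D -> Prop) (PQ : forall x, P x -> Q (F x)) :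
    (forall x, Q (F x) -> P x) ->
    (forall z t, isomorphic z t -> Q t -> Q z) ->
  ess_surj F -> ess_surj (frestrict PQ).
Proof.
move=> QP Qiso essF [z Qz]; have [x Fx_z] := essF z.
by exists (exist _ x (QP _ (Qiso _ _ Fx_z Qz))); exact: Fx_z.
Qed.

End Equivalence.

(** * Bases *)

(** In a spanning family satisfying a relation with nonzero [i0]-th coefficient,
    the [i0]-th vector is a combination of the others; a spanning family from
    which no vector can be removed is thus free. *)
Lemma finite_dim_basis (k : fieldType) (V : lmodType k) :
  finite_dim V -> exists (n : nat) (e : 'I_n -> V),
    (forall v, exists c : 'I_n -> k, v = \sum_i c i *: e i) /\
    (forall c : 'I_n -> k, \sum_i c i *: e i = 0 -> forall i, c i = 0).
Proof.
case=> n; elim: n => [|n IHn] [e span_e].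
  by exists 0%N, e; split=> // c _ [].
have [free_e|] := pselect (forall c : 'I_n.+1 -> k,
    \sum_i c i *: e i = 0 -> forall i, c i = 0).
  by exists n.+1, e.
move=> /existsNP[c] /not_implyP[ce0] /existsNP[i0] /eqP c0.
apply: IHn; exists (e \o lift i0) => v; have [d ->] := span_e v.
exists (fun j => d (lift i0 j) - d i0 / c i0 * c (lift i0 j)).
have e0E : e i0 = - \sum_j (c (lift i0 j) / c i0) *: e (lift i0 j).
  apply: (scalerI c0); rewrite scalerN scaler_sumr; apply/eqP.
  rewrite -addr_eq0 -[X in _ == X]ce0 (bigD1_ord i0) //=; apply/eqP.
  congr (_ + _).
  by apply: eq_bigr => j _; rewrite scalerA mulrC divfK.
rewrite (bigD1_ord i0) //= e0E scalerN scaler_sumr -sumrN -big_split /=.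
apply: eq_bigr => j _; rewrite scalerBl addrC scalerA; congr (_ - _ *: _).
by rewrite mulrA mulrAC.
Qed.

(** * Linear maps on free modules *)

Section FreeModuleMaps.
Variable k : fieldType.

Lemma kbind_gen (X : finType) (Y : choiceType) (f : X -> {malg k[Y]}) x :
  kbind f << x >> = f x.
Proof.
rewrite kbindE (bigD1 x) //= mcoeffU eqxx scale1r big1 ?addr0 // => y yx.
by rewrite mcoeffU eq_sym (negbTE yx) scale0r.
Qed.

(** The universal property of the free module.  Linearity is a hypothesis on a
    bare function because the maps in question come from A-modules, where
    k-linearity is a consequence to be proved. *)
Lemma kbind_linear (X : finType) (Y : choiceType)
    (T : {malg k[X]} -> {malg k[Y]}) :
  linear T -> kbind (fun x => T << x >>) =1 T.
Proof.
move=> linT v.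
pose T' : {linear {malg k[X]} -> {malg k[Y]}} :=
  HB.pack T (GRing.isLinear.Build k _ _ *:%R T linT).
rewrite kbindE -[T]/(T' : _ -> _) [in RHS](malgE v) linear_sum.
by apply: eq_bigr => x _; rewrite linearZ.
Qed.

(** Operators of a free module are compared through their matrices acting on
    its vectors, which avoids computing with entries. *)
Lemma eq_mx_colM (X : finType) m (P Q : 'M[k]_(m, #|X|)) :
  (forall v : {malg k[X]}, P *m colM v = Q *m colM v) -> P = Q.
Proof.
move=> PQ; apply/matrixP => i j.
have /colP/(_ i) := PQ (Mcol (delta_mx j 0)).
by rewrite McolK -!colE !mxE.
Qed.

(** The coefficient at [(i, j)] is the one of [[i]] in [f j], target first, so
    that convolution matches composition of arrows. *)
Definition conv_of_arrow (X : finType) (f : X -> {malg k[X]}) : H k X :=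
  fun=> \sum_p (f p.2)@_p.1 *: << p >>.

Lemma Phi_conv_of_arrow (X : finType) (f : X -> {malg k[X]}) :
  Phi (conv_of_arrow f) = kmx f.
Proof.
apply/matrixP => i j; rewrite !mxE /hcoef /conv_of_arrow raddf_sum /=.
rewrite (bigD1 (enum_val i, enum_val j)) //= mcoeffZ mcoeffU eqxx mulr1.
rewrite big1 ?addr0 // => p pij.
by rewrite mcoeffZ mcoeffU (negbTE pij) mulr0.
Qed.

End FreeModuleMaps.

Lemma finite_dim_free (k : fieldType) (V : lmodType k) :
  finite_dim V -> exists (n : nat) (u : {malg k['I_n]} -> V),
    linear u /\ bijective u.
Proof.
move=> /finite_dim_basis[n [e [span_e free_e]]].
pose u (v : {malg k['I_n]}) := \sum_i v@_i *: e i.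
have u_lin : linear u.
  move=> c v w; rewrite /u scaler_sumr -big_split; apply: eq_bigr => i _ /=.
  by rewrite mcoeffD mcoeffZ scalerDl scalerA.
have u_inj : injective u.
  move=> v w uvw; apply/malgP => i; apply/eqP; rewrite -subr_eq0; apply/eqP.
  apply: (free_e (fun i => v@_i - w@_i)); apply/eqP; move/eqP: uvw.
  rewrite -subr_eq0 -sumrB; congr (_ == 0).
  by apply: eq_bigr => j _; rewrite scalerBl.
pose w m : {malg k['I_n]} := \sum_i sval (cid (span_e m)) i *: << i >>.
have wK : cancel w u.
  move=> m; rewrite /u [RHS](svalP (cid (span_e m))); apply: eq_bigr => i _.
  congr (_ *: _); rewrite raddf_sum (bigD1 i) //= mcoeffZ mcoeffU eqxx mulr1.
  by rewrite big1 ?addr0 // => j ji; rewrite mcoeffZ mcoeffU (negbTE ji) mulr0.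
by exists n, u; split=> //; exists w => // v; exact: u_inj.
Qed.

(** * The functor to modules *)

Section Representations.
Variables (k : fieldType) (A : kalgebra k).

Lemma kscale_linear (M N : lmodType A) (g : {linear M -> N}) :
  linear (g : kspace M -> kspace N).
Proof. by move=> c m n; rewrite !kscaleE; exact: linearP. Qed.

Lemma FA_fully_faithful : fully_faithful (FA A).
Proof.
move=> R S; split=> [f g fg|g].
  apply/klchomP/funext => x; rewrite -(kbind_gen (klarr f)).
  rewrite -(kbind_gen (klarr g)).
  exact: (congr1 (fun h : rephom (Fmod R) (Fmod S) => rephom_fun h << x >>) fg).
pose T : {malg k[klset R]} -> {malg k[klset S]} := rephom_fun g.
have linT : linear T.
  move=> c v w; rewrite -!Fmod_kscaleE; exact: (kscale_linear g).
have TP a : klmx S a *m kmx (fun x => T << x >>)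
    = kmx (fun x => T << x >>) *m klmx R a.
  apply: eq_mx_colM => v; rewrite -!mulmxA -colM_kbind kbind_linear //.
  rewrite -[klmx R a *m colM v]McolK -colM_kbind kbind_linear //.
  (* What is left is A-linearity of [g] at [v]. *)
  rewrite -[LHS]McolK; congr (colM _); apply/esym.
  exact: (linearZZ (g : {linear Fmod R -> Fmod S}) a v).
exists (KlcHom TP); apply: rephomP => v; exact: kbind_linear.
Qed.

(** A k-linear bijection [u] from a free module onto M, with inverse [w], turns
    the action of [a] on M into the operator [op a] of the free module; its
    matrix is [theta a].  Since a matrix is determined by its action on vectors
    ([theta_ext]), each law of an algebra morphism for [theta] is the
    corresponding module law of M conjugated by [u]. *)
Section Transport.
Variables (X : finType) (M : lmodType A).
Variables (u : {malg k[X]} -> kspace M) (w : kspace M -> {malg k[X]}).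
Hypotheses (u_lin : linear u) (uK : cancel u w) (wK : cancel w u).

Let op (a : A) (v : {malg k[X]}) : {malg k[X]} := w (a *: (u v : M) : M).

Let w_lin : linear w.
Proof. by move=> c m n; apply: (can_inj uK); rewrite u_lin !wK. Qed.

(** Acting by [a] commutes with the scalars of k because these act on M through
    central elements of A. *)
Let op_lin a : linear (op a).
Proof.
move=> c v t; rewrite /op u_lin -w_lin; congr (w _).
by rewrite !kscaleE scalerDr !scalerA kalg_central.
Qed.

Let theta (a : A) : H k X := conv_of_arrow (fun x => op a << x >>).

Let thetaE a v : Phi (theta a) *m colM v = colM (op a v).
Proof. by rewrite Phi_conv_of_arrow -colM_kbind kbind_linear. Qed.

Let theta_ext f a : (forall v, Phi f *m colM v = colM (op a v)) -> theta a = f.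
Proof. by move=> fE; apply/Phi_inj/eq_mx_colM => v; rewrite thetaE fE. Qed.

Let w_add : {morph w : m n / m + n}.
Proof. by move=> m n; have := w_lin 1 m n; rewrite !scale1r. Qed.

Let theta_zmod : zmod_morphism theta.
Proof.
move=> a b; apply: theta_ext => v.
rewrite [Phi _]PhiD [Phi (- _)]PhiN mulmxBl !thetaE -raddfB; congr (colM _).
apply/eqP; rewrite subr_eq /op -w_add; apply/eqP; congr (w _).
by rewrite -[RHS](scalerDl (u v : M)) subrK.
Qed.

Let theta_monoid : monoid_morphism theta.
Proof.
split=> [|a b]; apply: theta_ext => v.
  by rewrite [Phi _]Phi1 mul1mx /op scale1r uK.
by rewrite [Phi _]PhiM -mulmxA !thetaE /op wK scalerA.
Qed.

HB.instance Definition _ := GRing.isZmodMorphism.Build A (H k X) theta theta_zmod.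
HB.instance Definition _ :=
  GRing.isMonoidMorphism.Build A (H k X) theta theta_monoid.

Let theta_str c : theta (kalg_str A c) = hstr X c.
Proof.
apply: theta_ext => v; rewrite /hstr [Phi _]PhiZ [Phi 1]Phi1 scalemx1.
rewrite mul_scalar_mx -linearZ; congr (colM _); apply: (can_inj uK).
have u0 : u 0 = 0 by have := u_lin (-1) 0 0; rewrite !scaleN1r !addNr.
by rewrite wK -[c *: v]addr0 u_lin u0 addr0.
Qed.

Definition transport_klc : klcob A :=
  @KlcOb k A X (@KAlgHom k A (Halg k X) (theta : {rmorphism A -> H k X}) theta_str).

Lemma transport_linear : linear (u : Fmod transport_klc -> M).
Proof.
move=> a v t; have /= := u_lin 1 (a *: (v : Fmod transport_klc)) t.
rewrite !scale1r => ->; congr (_ + _).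
by rewrite Fmod_scaleE thetaE colMK wK.
Qed.

Lemma transport_inv_linear : linear (w : M -> Fmod transport_klc).
Proof. by move=> a m n; apply: (can_inj uK); rewrite transport_linear !wK. Qed.

End Transport.

Lemma FA_ess_surj : ess_surj (FA A).
Proof.
move=> [M finM]; have [n [u [u_lin [w uK wK]]]] := finite_dim_free finM.
exists (transport_klc u_lin uK wK).
exists (mkrephom (@transport_linear _ _ _ _ u_lin uK wK)).
exists (mkrephom (@transport_inv_linear _ _ _ _ u_lin uK wK)).
by split; apply: rephomP; [exact: uK | exact: wK].
Qed.

(** A lifting problem for P becomes one for Q along the inverse isomorphism [w],
    and its solution comes back along [u]. *)
Lemma projective_iso (P Q : repob A) :
  isomorphic (C := rep A) P Q -> projective Q -> projective P.
Proof.
move=> [u [w [wu uw]]] projQ M N g f g_surj.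
have [h hP] := projQ M N g (repcomp f w) g_surj.
exists (repcomp h u) => p; rewrite /= hP /=; congr (f _).
exact: (congr1 (fun t : rephom P P => rephom_fun t p) wu).
Qed.

End Representations.

Theorem proposition6p7 (k : fieldType) (A : kalgebra k)
    (finA : finite_dim_alg A) :
  is_equivalence (FA_proj A).
Proof.
apply: fully_faithful_equivalence.
  exact/fully_faithful_restrict/FA_fully_faithful.
apply: ess_surj_restrict (@FA_ess_surj k A) => //.
exact: projective_iso.
Qed.
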